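(* Let $0<M<N$ be integers and let $(a_{ij})_{i,j=1}^N$ be a real matrix. Let the functions $\beta_{ij}$ ($i,j=1,\dots,N$) on $\mathbb{R}^N$ be defined from $(a_{ij})$ as in the context, and define, for $\mathrm{U}\in\mathbb{R}^N$, $$b_{ij}(\mathrm{U})=-\max\{\beta_{ij}(\mathrm{U})\,a_{ij},\,0,\,\beta_{ji}(\mathrm{U})\,a_{ji}\},\quad i\neq j,\qquad b_{ii}(\mathrm{U})=-\sum_{j\ne i}b_{ij}(\mathrm{U}),\qquad i,j=1,\dots,N.$$ For $i=1,\dots,M$ let $$S_i=\{j\in\{1,\dots,N\}\setminus\{i\}\,;\ a_{ij}\neq0\ \text{ or }\ a_{ji}>0\}.$$ Then, for any $\mathrm{U}=(u_1,\dots,u_N)\in\mathbb{R}^N$ and any $i\in\{1,\dots,M\}$, if either $u_i>u_j$ for all $j\in S_i$ or $u_i<u_j$ for all $j\in S_i$, then $$a_{ij}+b_{ij}(\mathrm{U})\le0\qquad\forall\,j\in S_i.$$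
   Context: For a real number $a$, $a^+=\max\{a,0\}$ and $a^-=\min\{a,0\}$. Definition of $\beta_{ij}=\beta_{ij}(\mathrm{U})$, $\mathrm{U}=(u_1,\dots,u_N)$: let $q_{ij}=\max\{|a_{ij}|,a_{ji}\}$. For $i\in\{1,\dots,M\}$ set $$P_i^{+}=\sum_{j:\,a_{ij}>0}a_{ij}(u_i-u_j)^{+},\quad P_i^{-}=\sum_{j:\,a_{ij}>0}a_{ij}(u_i-u_j)^{-},$$ $$Q_i^{+}=\sum_{j=1}^N q_{ij}(u_j-u_i)^{+},\quad Q_i^{-}=\sum_{j=1}^N q_{ij}(u_j-u_i)^{-},$$ $$R_i^{+}=\min\Big\{1,\frac{Q_i^{+}}{P_i^{+}}\Big\},\quad R_i^{-}=\min\Big\{1,\frac{Q_i^{-}}{P_i^{-}}\Big\},$$ where $j$ ranges over $\{1,\dots,N\}$; if $P_i^+=0$ (resp. $P_i^-=0$), then $R_i^+$ (resp. $R_i^-$) is assigned an arbitrary value in $[0,1]$. For $i=M+1,\dots,N$ set $R_i^+=R_i^-=1$. Then $$\beta_{ij}=\begin{cases}1-R_i^+ & \text{if } u_i>u_j,\\ 0 & \text{if } u_i=u_j,\\ 1-R_i^- & \text{if } u_i<u_j,\end{cases}\qquad i,j=1,\dots,N.$$ *)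

(* Defs.v *)
From mathcomp Require Import all_boot all_order all_algebra.
From mathcomp Require Import reals.

Set Implicit Arguments.
Unset Strict Implicit.
Unset Printing Implicit Defensive.

Import Order.TTheory GRing.Theory Num.Theory.

Local Open Scope ring_scope.

(* Indices are 0-based: i : 'I_N stands for the index i + 1, so
   that the range {1, ..., M} is the condition (i < M)%N. *)
Section Definitions.
Context {R : realType} {N : nat}.
Implicit Types (A : 'M[R]_N) (U : 'rV[R]_N) (i j : 'I_N).

Definition pos_part (x : R) : R := Num.max x 0.

(* Nonpositive: the negative part is min(x, 0), not max(-x, 0). *)
Definition neg_part (x : R) : R := Num.min x 0.

Definition q A i j : R := Num.max `|A i j| (A j i).

Definition Pplus A U i : R :=
  \sum_(j < N | 0 < A i j) A i j * pos_part (U 0 i - U 0 j).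

Definition Pminus A U i : R :=
  \sum_(j < N | 0 < A i j) A i j * neg_part (U 0 i - U 0 j).

Definition Qplus A U i : R := \sum_(j < N) q A i j * pos_part (U 0 j - U 0 i).

Definition Qminus A U i : R := \sum_(j < N) q A i j * neg_part (U 0 j - U 0 i).

(* The arguments rp and rm below are the arbitrary values given to R_i^+ and
   R_i^- when the denominator P_i^+, resp. P_i^-, vanishes; they may depend on
   both U and i, and are unused otherwise. *)
Definition Rplus (M : nat) A (rp : 'rV[R]_N -> 'I_N -> R) U i : R :=
  if (i < M)%N then
    if Pplus A U i == 0 then rp U i
    else Num.min 1 (Qplus A U i / Pplus A U i)
  else 1.

Definition Rminus (M : nat) A (rm : 'rV[R]_N -> 'I_N -> R) U i : R :=
  if (i < M)%N then
    if Pminus A U i == 0 then rm U i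
    else Num.min 1 (Qminus A U i / Pminus A U i)
  else 1.

Definition beta (M : nat) A (rp rm : 'rV[R]_N -> 'I_N -> R) U i j : R :=
  if U 0 j < U 0 i then 1 - Rplus M A rp U i
  else if U 0 i < U 0 j then 1 - Rminus M A rm U i
  else 0.

Definition b_offdiag (M : nat) A (rp rm : 'rV[R]_N -> 'I_N -> R) U i j : R :=
  - Num.max (Num.max (beta M A rp rm U i j * A i j) 0)
            (beta M A rp rm U j i * A j i).

Definition b (M : nat) A (rp rm : 'rV[R]_N -> 'I_N -> R) U i j : R :=
  if i == j then - \sum_(k < N | k != i) b_offdiag M A rp rm U i k
  else b_offdiag M A rp rm U i j.

Definition stencil A i : {set 'I_N} :=
  [set j | (j != i) && ((A i j != 0) || (0 < A j i))].

End Definitions.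

(* Main.v *)
(* At a strict local maximum u_i over the stencil, every term of Q_i^+ vanishes,
   because q_ij = 0 off the stencil.  If moreover a_ij > 0 for some stencil
   index j, then P_i^+ > 0, so R_i^+ = 0, beta_ij = 1 and b_ij <= - a_ij.
   Minima reduce to maxima through U |-> - U. *)
Require Import Defs.
From mathcomp Require Import all_boot all_order all_algebra.
From mathcomp Require Import reals.

Set Implicit Arguments.
Unset Strict Implicit.

Import Order.TTheory GRing.Theory Num.Theory.

Local Open Scope ring_scope.

Section Limiter.
Context {R : realType} {N : nat}.
Implicit Types (A : 'M[R]_N) (U : 'rV[R]_N) (i j : 'I_N).

(** Off the stencil, a_ij = 0 and a_ji <= 0, so the maximum of |a_ij| and a_ji is 0. The diagonal is
    excluded because q_ii can be positive. *)
Lemma q_eq0 A i j : j != i -> j \notin stencil A i -> q A i j = 0.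
Proof.
rewrite inE => -> /=; rewrite negb_or negbK -leNgt => /andP[/eqP Aij0 Aji_le0].
by rewrite /q Aij0 normr0; apply/max_idPl.
Qed.

Lemma neg_partN (x : R) : neg_part x = - pos_part (- x).
Proof. by rewrite /neg_part /pos_part oppr_max opprK oppr0. Qed.

Lemma PminusN A U i : Pminus A U i = - Pplus A (- U) i.
Proof.
rewrite /Pminus /Pplus -sumrN; apply: eq_bigr => j _.
by rewrite neg_partN mulrN !mxE opprD.
Qed.

Lemma QminusN A U i : Qminus A U i = - Qplus A (- U) i.
Proof.
rewrite /Qminus /Qplus -sumrN; apply: eq_bigr => j _.
by rewrite neg_partN mulrN !mxE opprD.
Qed.

Lemma Qplus_eq0 A U i :
  (forall j, j \in stencil A i -> U 0 j < U 0 i) -> Qplus A U i = 0.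
Proof.
move=> Umax; apply: big1 => j _.
(* The diagonal term vanishes through u_i - u_i = 0 rather than through its weight. *)
have [->|ji] := eqVneq j i; first by rewrite subrr /pos_part maxxx mulr0.
have [/Umax Uji|jS] := boolP (j \in stencil A i); last by rewrite q_eq0 ?mul0r.
by rewrite /pos_part (max_idPr _) ?mulr0// subr_le0 ltW.
Qed.

(** All terms are nonnegative, so one positive term suffices. This puts R_i^+ in its quotient
    branch, away from the arbitrary value [rp U i]. *)
Lemma Pplus_neq0 A U i j : 0 < A i j -> U 0 j < U 0 i -> Pplus A U i != 0.
Proof.
move=> Aij Uji; rewrite psumr_neq0 => [|k Aik].
  apply/hasP; exists j; first by rewrite mem_index_enum.
  by rewrite Aij mulr_gt0// /pos_part lt_max subr_gt0 Uji.
by rewrite mulr_ge0 ?(ltW Aik)// /pos_part le_max lexx orbT.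
Qed.

Lemma Rplus_eq0 M A rp U i j : (i < M)%N -> 0 < A i j -> U 0 j < U 0 i ->
  (forall k, k \in stencil A i -> U 0 k < U 0 i) -> Rplus M A rp U i = 0.
Proof.
move=> iM Aij Uji Umax; rewrite /Rplus iM (negPf (Pplus_neq0 Aij Uji)).
by rewrite Qplus_eq0// mul0r (min_idPr _).
Qed.

(** Under reflection, numerator and denominator both change sign, so the quotient is kept. Composing
    [r] with negation makes the fallback value at [- U] equal to [r U i]. *)
Lemma Rminus_Rplus M A r U i : Rminus M A r U i = Rplus M A (r \o -%R) (- U) i.
Proof.
rewrite /Rminus /Rplus PminusN QminusN oppr_eq0 /= opprK.
by rewrite invrN mulrNN.
Qed.

Lemma beta_eq1 M A rp rm U i j : (i < M)%N -> 0 < A i j -> j \in stencil A i ->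
  (forall k, k \in stencil A i -> U 0 k < U 0 i) \/
  (forall k, k \in stencil A i -> U 0 i < U 0 k) ->
  beta M A rp rm U i j = 1.
Proof.
move=> iM Aij jS [] Uext; have Uij := Uext j jS; rewrite /beta.
  by rewrite Uij (Rplus_eq0 _ iM Aij Uij) ?subr0.
(* Reflection leaves [A] and its stencil unchanged, and [Rplus_eq0] holds for any fallback values,
   so it applies at [- U]. *)
rewrite ltNge (ltW Uij) Uij /= Rminus_Rplus.
rewrite (Rplus_eq0 _ iM Aij) ?subr0 ?mxE ?ltrN2// => k kS.
by rewrite !mxE ltrN2; apply: Uext.
Qed.

End Limiter.

Theorem theorem6 (R : realType) (M N : nat) (hM : (0 < M)%N) (hMN : (M < N)%N)
  (A : 'M[R]_N) (rp rm : 'rV[R]_N -> 'I_N -> R)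
  (hrp : forall (U : 'rV[R]_N) (i : 'I_N), 0 <= rp U i <= 1)
  (hrm : forall (U : 'rV[R]_N) (i : 'I_N), 0 <= rm U i <= 1)
  (U : 'rV[R]_N) (i : 'I_N) (hi : (i < M)%N) :
  (forall j : 'I_N, j \in stencil A i -> U 0 j < U 0 i) \/
  (forall j : 'I_N, j \in stencil A i -> U 0 i < U 0 j) ->
  forall j : 'I_N, j \in stencil A i -> A i j + b M A rp rm U i j <= 0.
Proof.
move=> Uext j jS; have /andP[ji _] : (j != i) && ((A i j != 0) || (0 < A j i)).
  by move: jS; rewrite inE.
rewrite /b eq_sym (negPf ji) /b_offdiag subr_le0 !le_max.
(* It remains to bound a_ij by one entry of the maximum: 0 if a_ij <= 0, and beta_ij a_ij = a_ij
   otherwise. *)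
have [Aij_le0|Aij] := leP (A i j) 0; first by rewrite orbT.
by rewrite (beta_eq1 _ _ hi Aij jS Uext) mul1r lexx.
Qed.
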